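(* Let $n\ge 2$, let $p(z)=\prod_{j=1}^{n}(z-z_j)$ be a complex polynomial of degree $n$ with zeros $z_1,z_2,\ldots,z_n\in\mathbb{C}$, and let $w_1,w_2,\ldots,w_{n-1}$ be its critical points. Assume that $\sum_{j=1}^n z_j=0$. Then $$\sum_{k=1}^{n-1}|w_k|\le\sqrt{\frac{n-2}{n}}\,\sum_{j=1}^n|z_j|.$$
   Context: The critical points of a polynomial $p(z)$ of degree $n$ are the $n-1$ zeros of its derivative $p'(z)$. Zeros and critical points are listed with multiplicity. *)

(* Defs.v *)
From mathcomp Require Import all_boot all_order all_algebra.
From mathcomp Require Import complex reals.
Set Implicit Arguments.
Unset Strict Implicit.
Unset Printing Implicit Defensive.
Import GRing.Theory.
Local Open Scope ring_scope.

(* The family [s] lists the zeros of the nonzero polynomial [q] with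
   multiplicity: each zero occurs in [s] as often as its multiplicity, in any
   order, so that in particular [size q = m.+1]. *)
Definition lists_roots (F : idomainType) (m : nat) (q : {poly F})
    (s : 'I_m -> F) : Prop :=
  q != 0 /\ q = lead_coef q *: \prod_(k < m) ('X - (s k)%:P).

Definition critical_points (F : idomainType) (m : nat) (p : {poly F})
    (w : 'I_m -> F) : Prop :=
  lists_roots p^`() w.

(* Main.v *)
Require Import Defs.
From mathcomp Require Import all_boot all_order all_algebra.
From mathcomp Require Import complex reals.
From mathcomp Require Import ring.
Set Implicit Arguments.
Unset Strict Implicit.
Unset Printing Implicit Defensive.
Import Order.TTheory GRing.Theory Num.Theory.
Local Open Scope ring_scope.
Local Open Scope sesquilinear_scope.

(** Let [e] be the all-ones vector, [P = I - e e^T / n] the orthogonal projection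
    onto its complement, and [D] the diagonal matrix of the zeros [z_j]. The
    compression [P D P] has characteristic polynomial [X p'(X) / n], so its
    eigenvalues are [0] and the critical points ([char_poly_centering]).

    Triangularize [P D P] in an orthonormal basis and multiply each diagonal entry
    by the phase that makes it nonnegative. With [U] the unitary change of basis,
    [Theta] the diagonal matrix of these phases and [N = P U^* Theta U P], this
    gives [sum_k |w_k| = tr (D N) = sum_j z_j c_j], where [c_j = N_jj]. The matrix
    [N] is killed by [e] on both sides, and each of its rows and columns has
    squared norm at most that of [P e_j], which is [(n - 1) / n].

    It remains to bound the pairing of [z] with the diagonal of such an [N]
    ([diag_pairing_le]). Give [j] the weight [a_j = |z_j|], put [S = sum_j a_j],
    let [m] be the weighted mean of the [c_j] and [V = sum_j a_j |c_j - m|^2].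
    Since [sum_j z_j = 0], the pairing equals [sum_j z_j (c_j - m)], and by
    Cauchy-Schwarz it is at most [sqrt (S V)]; so [V <= S (n - 2) / n] suffices.

    The crude bound [|c_j| <= (n - 1) / n] only yields the constant
    [(n - 1) / n]. The gain comes from the off-diagonal entries: the vanishing row
    and column sums express [2 V] through [sum_(i != j) (a_i y_i + a_j y_j) N_ij]
    with [y = c - m] up to conjugation, and a weighted Cauchy-Schwarz inequality
    on pairs [i != j] gives [V <= (n - 2) Q] with [Q] the weighted off-diagonal
    mass. Without further care the factor would be [n - 1]; the missing [1] is the
    spectral gap on mean-zero vectors of the weighted graph Laplacian with edge
    weights [a_i a_j / (a_i + a_j)], and it appears on bounding these weights
    below by [a_i a_j / S] ([pair_bound]). As
    [Q + V <= S (n - 1) / n] by the norm bounds on [N], the estimate of [V]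
    follows ([var_le]). *)

(** * The characteristic polynomial of the compression *)

(** Both sides are read off the determinant of the bordered matrix
    [[1, -v], [u, diag f]]: block elimination on the left produces the rank-one
    update. On the right, elimination without division uses that
    [diag f] sends [k] to [(prod f) u], at the price of an extra factor [prod f],
    cancelled at the end. *)
Lemma det_diag_rank1 (D : idomainType) n (f u v : 'I_n -> D) :
    (forall i, f i != 0) ->
  \det (diag_mx (\row_i f i) + (\col_i u i) *m (\row_j v j)) =
    \prod_i f i + \sum_i v i * u i * \prod_(j | j != i) f j.
Proof.
move=> f0; set M := diag_mx _; set cu := \col_i _; set rv := \row_j v j.
pose dM := \prod_i f i.
have dM0 : dM != 0 by apply/prodf_neq0 => i _.
pose k := \col_i (u i * \prod_(j | j != i) f j).
have Mk : M *m k = dM *: cu.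
  apply/matrixP => i j; rewrite mul_diag_mx !mxE /dM [in RHS](bigD1 i) //=.
  by ring.
pose B := block_mx 1%:M (- rv) cu M.
have BE : \det B = \det (M + cu *m rv).
  have -> : B = block_mx 1%:M 0 cu 1%:M *m block_mx 1%:M (- rv) 0 (M + cu *m rv).
    rewrite mulmx_block !mul1mx ?mul0mx !mulmx1 ?mulmx0 !addr0.
    by rewrite mulmxN addrC addrK.
  by rewrite det_mulmx det_lblock det_ublock !det1 !mul1r.
have : \det (B *m block_mx dM%:M 0 (- k) 1%:M) =
       \det (block_mx (dM%:M + rv *m k) (- rv) 0 M).
  congr (\det _); rewrite mulmx_block !mul1mx !mulmx1 ?mulmx0 !add0r.
  by rewrite mulmxN mulNmx opprK mulmxN Mk mul_mx_scalar subrr.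
rewrite det_mulmx det_lblock det_ublock BE det1 mulr1 det_scalar1 det_diag.
rewrite det_mx11 (eq_bigr f) => [|i _]; last by rewrite !mxE.
move=> /(mulIf dM0) ->; rewrite !mxE eqxx mulr1n; congr (_ + _).
by apply: eq_bigr => i _; rewrite !mxE mulrA.
Qed.

(** Eliminating the lower left block of [[X, A], [B, 1]] from the right gives
    [X - A B] and from the left [X - B A], up to the regular factor [X ^ n]. *)
Lemma char_poly_mulmxC (R : idomainType) n (A B : 'M[R]_n) :
  char_poly (A *m B) = char_poly (B *m A).
Proof.
pose a := map_mx polyC A; pose b := map_mx polyC B.
rewrite /char_poly /char_poly_mx !map_mxM -/a -/b.
pose M := block_mx 'X%:M a b 1%:M.
have X0 : \det ('X%:M : 'M[{poly R}]_n) != 0.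
  by rewrite det_scalar expf_neq0 // polyX_eq0.
have l : \det (M *m block_mx 1%:M 0 (- b) 1%:M) =
    \det (block_mx ('X%:M - a *m b) a 0 1%:M).
  congr (\det _); rewrite mulmx_block !mulmx1 ?mulmx0 !add0r mul1mx.
  by rewrite mulmxN subrr.
have r : \det (block_mx 1%:M 0 (- b) 'X%:M *m M) =
    \det (block_mx 'X%:M a 0 ('X%:M - b *m a)).
  congr (\det _); rewrite mulmx_block !mul1mx ?mul0mx !addr0 mulmx1.
  by rewrite mulNmx mulNmx mul_mx_scalar mul_scalar_mx addNr addrC.
move: l r; rewrite !det_mulmx !det_lblock !det_ublock !det1 !mulr1 !mul1r.
by move=> -> /(mulfI X0).
Qed.

Lemma deriv_prod (R : comNzRingType) (I : finType) (g : I -> {poly R}) :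
  (\prod_i g i)^`() = \sum_i (g i)^`() * \prod_(j | j != i) g j.
Proof.
elim: (index_enum I) (index_enum_uniq I) => [_|x r IHr /= /andP[xr ur]].
  by rewrite !big_nil derivC.
rewrite !big_cons eqxx /= derivM IHr // mulr_sumr; congr (_ * _ + _).
  rewrite big_seq [in RHS]big_seq_cond; apply: eq_bigl => j.
  by case jr: (j \in r); rewrite //=; apply/esym; apply: contraNneq xr => <-.
rewrite big_seq [in RHS]big_seq; apply: eq_bigr => i ir.
rewrite big_cons (_ : x != i) 1?mulrCA //.
by apply: contraNneq xr => ->.
Qed.

(** The orthogonal projection onto the vectors with coordinate sum [0]. *)
Definition centering (F : fieldType) n : 'M[F]_n := 1%:M - const_mx n%:R^-1.

Section Centering.
Variables (F : numFieldType) (n : nat).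
Hypothesis n_gt0 : (0 < n)%N.
Let n0 : n%:R != 0 :> F.
Proof. by rewrite pnatr_eq0 -lt0n. Qed.

Lemma trmx_centering : (centering F n)^T = centering F n.
Proof. by rewrite linearB /= trmx1 trmx_const. Qed.

Lemma centering_row_sum0 i : \sum_j centering F n i j = 0.
Proof.
under eq_bigr do rewrite !mxE.
rewrite sumrB sumr_const card_ord -[_ *+ n]mulr_natl divff // (bigD1 i) //= eqxx.
by rewrite big1 ?addr0 ?subrr // => j /negPf; rewrite eq_sym => ->.
Qed.

Lemma centering_idem : centering F n *m centering F n = centering F n.
Proof.
rewrite {1}/centering mulmxBl mul1mx -[RHS]subr0; congr (_ - _).
apply/matrixP => i j; rewrite !mxE; under eq_bigr do rewrite mxE.
by rewrite -mulr_sumr -trmx_centering; under eq_bigr do rewrite mxE;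
  rewrite centering_row_sum0 mulr0.
Qed.

(** Cyclicity replaces [P D P] by [D P], which is diagonal plus rank one. The
    term [z_i / n] of the rank-one formula and the [1 / n]-th part of the full
    product then combine to [X / n] times the [i]-th summand of [p']. *)
Lemma char_poly_centering (z : 'I_n -> F) :
  char_poly (centering F n *m diag_mx (\row_j z j) *m centering F n) =
  'X * (n%:R^-1 *: (\prod_j ('X - (z j)%:P))^`()).
Proof.
rewrite -mulmxA char_poly_mulmxC -mulmxA centering_idem.
rewrite /char_poly.
have -> : char_poly_mx (diag_mx (\row_j z j) *m centering F n) =
   diag_mx (\row_i ('X - (z i)%:P)) +
    (\col_i (z i)%:P) *m (\row_j (n%:R^-1)%:P).
  apply/matrixP => i j; rewrite mul_diag_mx !mxE big_ord1 !mxE.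
  rewrite mulrBr polyCB !polyCM mulrnBl opprB addrA addrAC; congr (_ + _).
  by case: eqP; rewrite ?mulr1n ?mulr0n ?mulr1 ?mulr0.
rewrite det_diag_rank1 => [|i]; last by rewrite polyXsubC_eq0.
rewrite deriv_prod scaler_sumr mulr_sumr.
under [in RHS]eq_bigr do rewrite derivXsubC mul1r.
have e i : 'X * (n%:R^-1 *: \prod_(j | j != i) ('X - (z j)%:P)) =
   n%:R^-1 *: \prod_j ('X - (z j)%:P) +
   (n%:R^-1)%:P * (z i)%:P * \prod_(j | j != i) ('X - (z j)%:P).
  by rewrite [in RHS](bigD1 i) //= -!mul_polyC; ring.
rewrite (eq_bigr _ (fun i _ => e i)) big_split /= sumr_const card_ord.
by rewrite -scaler_nat scalerA divff // scale1r.
Qed.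

End Centering.

(** * Pairing a vector with the diagonal of a centered matrix *)

Section Pairing.
Variable C : numClosedFieldType.

Lemma normC_subXX (x y : C) :
  `|x - y| ^+ 2 = `|x| ^+ 2 + `|y| ^+ 2 - (x * y^* + x^* * y).
Proof. by rewrite !normCK rmorphB /=; ring. Qed.

Lemma sum_offdiag (V : zmodType) n (F : 'I_n -> 'I_n -> V) :
  \sum_j \sum_(i | i != j) F i j = \sum_j \sum_i F i j - \sum_j F j j.
Proof.
rewrite -sumrB; apply: eq_bigr => j _.
by rewrite [in RHS](bigD1 j) //= [in RHS]addrAC subrr add0r.
Qed.

(** Twice the total weight squared times the variance, as a double sum. It enters
    both as a lower bound (Cauchy-Schwarz) and as the exact value of the gap term
    in [var_param]. *)
Lemma sum_pair_dist_sqr n (a y : 'I_n -> C) (ha : forall i, 0 <= a i) :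
  \sum_j \sum_i a i * a j * `|y i - y j| ^+ 2 =
  2%:R * ((\sum_j a j) * (\sum_j a j * `|y j| ^+ 2)
          - `|\sum_j a j * y j| ^+ 2).
Proof.
have aJ i : (a i)^* = a i by exact/conj_Creal/ger0_real.
under eq_bigr => j _.
  under eq_bigr => i _.
    have -> : a i * a j * `|y i - y j| ^+ 2 =
       a j * (a i * `|y i| ^+ 2) + (a j * `|y j| ^+ 2) * a i
       - ((a j * y j)^* * (a i * y i) + (a j * y j) * (a i * (y i)^*)).
      by rewrite normC_subXX !rmorphM /= !aJ; ring.
    over.
  rewrite sumrB !big_split /= -!mulr_sumr; over.
rewrite sumrB !big_split /= -!mulr_suml -rmorph_sum normCK.
have -> : \sum_(i < n) a i * (y i)^* = (\sum_(i < n) a i * y i)^*.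
  by rewrite rmorph_sum; apply: eq_bigr => i _; rewrite rmorphM /= aJ.
by ring.
Qed.

(** Cauchy-Schwarz as nonnegativity of the variance in [sum_pair_dist_sqr]. *)
Lemma weighted_sqr_sum_le n (a b : 'I_n -> C) (ha : forall i, 0 <= a i) :
  (forall i, 0 <= b i) ->
  (\sum_j a j * b j) ^+ 2 <= (\sum_j a j) * (\sum_j a j * b j ^+ 2).
Proof.
move=> hb; rewrite -subr_ge0.
have s0 : 0 <= \sum_j a j * b j by apply: sumr_ge0 => j _; exact: mulr_ge0.
suff /(mulr_ge0 (_ : 0 <= 2%:R^-1 :> C)) : 0 <=
  2%:R * ((\sum_j a j) * (\sum_j a j * b j ^+ 2) - (\sum_j a j * b j) ^+ 2).
  by rewrite mulKf ?pnatr_eq0 //; apply; rewrite invr_ge0.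
have -> : \sum_j a j * b j ^+ 2 = \sum_j a j * `|b j| ^+ 2.
  by apply: eq_bigr => i _; rewrite ger0_norm.
rewrite -(ger0_norm s0) -sum_pair_dist_sqr //.
do 2![apply: sumr_ge0 => ? _].
by rewrite !mulr_ge0 // exprn_ge0.
Qed.

(** With [h = a + b], the identity
    [h (a|u|^2 + b|v|^2) = |a u + b v|^2 + a b |u - v|^2] leaves a complete square
    [(|a u + b v| - h t |x|)^2 / h] plus [a b |u - v|^2 (1 / h - 1 / S)].
    The constant [S] is the same for all pairs, so that the terms
    [a b |u - v|^2 / S] add up to a variance by [sum_pair_dist_sqr]; [t] is the
    free weight of a Cauchy-Schwarz inequality. *)
Lemma pair_bound (a b S t u v x : C) : 0 <= a -> 0 <= b -> 0 < S ->
    a + b <= S -> 0 <= t ->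
  2%:R * t * `|(a * u^* + b * v^*) * x| <=
    a * `|u| ^+ 2 + b * `|v| ^+ 2 - a * b * `|u - v| ^+ 2 / S
    + t ^+ 2 * ((a + b) * `|x| ^+ 2).
Proof.
move=> a0 b0 S0 abS t0.
have aJ : a^* = a by exact/conj_Creal/ger0_real.
have bJ : b^* = b by exact/conj_Creal/ger0_real.
have := addr_ge0 a0 b0; rewrite le0r => /predU1P[/eqP|h0].
  rewrite paddr_eq0 // => /andP[/eqP-> /eqP->].
  by rewrite !mul0r !add0r !mul0r normr0 !(mulr0, oppr0, addr0).
set h := a + b in abS h0 *.
have h1 : h != 0 by rewrite gt_eqF.
have -> : `|(a * u^* + b * v^*) * x| = `|a * u + b * v| * `|x|.
  rewrite normrM; congr (_ * _).
  by rewrite -[LHS]norm_conjC rmorphD !rmorphM /= !conjCK aJ bJ.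
have key : h * (a * `|u| ^+ 2 + b * `|v| ^+ 2) =
    `|a * u + b * v| ^+ 2 + a * b * `|u - v| ^+ 2.
  by rewrite normC_subXX !normCK rmorphD !rmorphM /= aJ bJ /h; ring.
set w := `|a * u + b * v| in key *.
rewrite -subr_ge0.
have -> : a * `|u| ^+ 2 + b * `|v| ^+ 2 - a * b * `|u - v| ^+ 2 / S
    + t ^+ 2 * (h * `|x| ^+ 2) - 2%:R * t * (w * `|x|) =
    (w - h * t * `|x|) ^+ 2 / h
    + a * b * `|u - v| ^+ 2 * (h^-1 - S^-1).
  rewrite (_ : a * `|u| ^+ 2 + b * `|v| ^+ 2 =
    (w ^+ 2 + a * b * `|u - v| ^+ 2) / h); last by rewrite -key [h * _]mulrC mulfK.
  by field; rewrite h1 gt_eqF.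
have wr : w - h * t * `|x| \is Num.real.
  by rewrite rpredB // ?normr_real // rpredM ?normr_real // rpredM //
    ger0_real // ltW.
apply: addr_ge0; first by rewrite divr_ge0 ?(ltW h0) // real_exprn_even_ge0.
rewrite !mulr_ge0 ?exprn_ge0 // subr_ge0.
by rewrite lef_pV2 // posrE.
Qed.

Section Compressed.
Variables (n : nat) (N : 'M[C]_n) (d : C).
Hypothesis col_sum0 : forall j, \sum_i N i j = 0.
Hypothesis row_sum0 : forall i, \sum_j N i j = 0.
Hypothesis col_sqr : forall j, \sum_i `|N i j| ^+ 2 <= d.
Hypothesis row_sqr : forall i, \sum_j `|N i j| ^+ 2 <= d.
Variable a : 'I_n -> C.
Hypothesis a_ge0 : forall j, 0 <= a j.
Let S := \sum_j a j.
Hypothesis S_gt0 : 0 < S.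
Let m := (\sum_j a j * N j j) / S.
Let y j := N j j - m.
Let V := \sum_j a j * `|y j| ^+ 2.

Let aJ i : (a i)^* = a i.
Proof. exact/conj_Creal/ger0_real. Qed.

Let V_ge0 : 0 <= V.
Proof. by apply: sumr_ge0 => j _; rewrite mulr_ge0 ?exprn_ge0. Qed.

Lemma dev_mean0 : \sum_j a j * y j = 0.
Proof.
rewrite /y; under eq_bigr do rewrite mulrBr.
by rewrite sumrB -mulr_suml /m mulrCA divff ?mulr1 ?subrr // gt_eqF.
Qed.

Lemma dev_meanJ0 : \sum_j a j * (y j)^* = 0.
Proof.
have /(congr1 (@Num.conj C)) := dev_mean0; rewrite rmorph0 rmorph_sum => sJ.
rewrite -[RHS]sJ; by apply: eq_bigr => j _; rewrite rmorphM /= aJ.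
Qed.

(** The same sum over all pairs vanishes, because rows and columns of [N] sum to
    zero; what is left is minus the diagonal, which is [2 V] as
    [N j j = y j + m] and the [y j] have weighted mean [0]. *)
Lemma var_offdiag :
  \sum_j \sum_(i | i != j) (a i * (y i)^* + a j * (y j)^*) * N i j
   = - (2%:R * V).
Proof.
rewrite sum_offdiag.
have -> : \sum_j \sum_i (a i * (y i)^* + a j * (y j)^*) * N i j = 0.
  under eq_bigr do (under eq_bigr do rewrite mulrDl; rewrite big_split /=
    -[X in _ + X]mulr_sumr col_sum0 mulr0 addr0).
  rewrite exchange_big /= big1 // => i _.
  by rewrite -mulr_sumr row_sum0 mulr0.
rewrite sub0r; congr (- _).
have NE j : N j j = y j + m by rewrite /y subrK.
under eq_bigr => j _.
  have -> : (a j * (y j)^* + a j * (y j)^*) * N j j =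
    2%:R * (a j * `|y j| ^+ 2) + (2%:R * m) * (a j * (y j)^*).
    by rewrite NE normCK; ring.
  over.
by rewrite big_split /= -!mulr_sumr dev_meanJ0 mulr0 addr0.
Qed.

Lemma sum_diag_sqr : V <= \sum_j a j * `|N j j| ^+ 2.
Proof.
have -> : \sum_j a j * `|N j j| ^+ 2 = V + S * `|m| ^+ 2.
  have NE j : N j j = y j + m by rewrite /y subrK.
  under eq_bigr => j _.
    have -> : a j * `|N j j| ^+ 2 = a j * `|y j| ^+ 2 + a j * `|m| ^+ 2
       + ((a j * y j) * m^* + (a j * (y j)^*) * m).
      by rewrite NE !normCK rmorphD /=; ring.
    over.
  rewrite !big_split /= -!mulr_suml dev_mean0 dev_meanJ0.
  by rewrite !mul0r !addr0.
by rewrite lerDl mulr_ge0 ?exprn_ge0 // ltW.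
Qed.

(** An off-diagonal entry is weighted once through its row and once through its
    column; both the rows and the columns have squared norm at most [d], from
    which the diagonal entries are taken off. *)
Lemma sum_offdiag_sqr :
  \sum_j \sum_(i | i != j) (a i + a j) * `|N i j| ^+ 2 <=
    2%:R * (S * d - V).
Proof.
rewrite sum_offdiag.
under eq_bigr do (under eq_bigr do rewrite mulrDl; rewrite big_split /=
    -[X in _ + X]mulr_sumr).
rewrite big_split /= exchange_big /=.
under eq_bigr do rewrite -mulr_sumr.
under [X in _ - X]eq_bigr do rewrite -mulr2n -mulr_natl -mulrA.
rewrite -mulr_sumr mulrBr; apply: lerB; last first.
  by rewrite ler_pM2l ?ltr0n ?sum_diag_sqr.
rewrite mulr_natl mulr2n /S mulr_suml; apply: lerD.
  by apply: ler_sum => i _; rewrite ler_wpM2l.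
by apply: ler_sum => i _; rewrite ler_wpM2l.
Qed.

(** The sum of [pair_bound] over the off-diagonal pairs. The squares contribute
    [2 (n - 1) V], and the gap term removes [2 V] more. *)
Lemma var_param t : 0 <= t ->
  2%:R * t * V <= (n%:R - 2%:R) * V + t ^+ 2 * (S * d - V).
Proof.
move=> t0.
have le1 : 2%:R * t * (2%:R * V) <= \sum_j \sum_(i | i != j)
   2%:R * t * `|(a i * (y i)^* + a j * (y j)^*) * N i j|.
  under eq_bigr do rewrite -mulr_sumr.
  rewrite -mulr_sumr ler_wpM2l ?mulr_ge0 //.
  have -> : 2%:R * V = `|- (2%:R * V)|.
    by rewrite normrN ger0_norm // mulr_ge0.
  rewrite -var_offdiag; apply: le_trans (ler_norm_sum _ _ _) _.
  by apply: ler_sum => j _; exact: ler_norm_sum.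
have le2 : \sum_j \sum_(i | i != j)
   2%:R * t * `|(a i * (y i)^* + a j * (y j)^*) * N i j| <=
   \sum_j \sum_(i | i != j) (a i * `|y i| ^+ 2 + a j * `|y j| ^+ 2
    - a i * a j * `|y i - y j| ^+ 2 / S
    + t ^+ 2 * ((a i + a j) * `|N i j| ^+ 2)).
  apply: ler_sum => j _; apply: ler_sum => i ij; apply: pair_bound => //.
  rewrite /S (bigD1 i) //= lerD2l (bigD1 j) 1?eq_sym //= lerDl.
  by apply: sumr_ge0.
have /le_trans/(_ le2) := le1.
under [X in _ <= X -> _]eq_bigr do rewrite big_split /= -mulr_sumr.
rewrite [X in _ <= X -> _]big_split /= -mulr_sumr sum_offdiag.
have -> : \sum_j \sum_i (a i * `|y i| ^+ 2 + a j * `|y j| ^+ 2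
    - a i * a j * `|y i - y j| ^+ 2 / S) = 2%:R * n%:R * V - 2%:R * V.
  under eq_bigr do rewrite sumrB big_split /= -/V sumr_const card_ord
    -mulr_suml.
  rewrite sumrB big_split /= sumr_const card_ord -mulr_suml sum_pair_dist_sqr //.
  rewrite dev_mean0 normr0 expr0n /= subr0 -/V -/S sumrMnl -/V.
  by rewrite -mulr_natl; field; rewrite gt_eqF.
have -> : \sum_j (a j * `|y j| ^+ 2 + a j * `|y j| ^+ 2
    - a j * a j * `|y j - y j| ^+ 2 / S) = 2%:R * V.
  rewrite /V mulr_sumr; apply: eq_bigr => j _.
  by rewrite subrr normr0 expr0n /=; ring.
move=> le3.
have le4 := le_trans le3 (lerD (lexx _) (ler_wpM2l (exprn_ge0 2 t0)
  sum_offdiag_sqr)).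
rewrite -(ler_pM2l (_ : 0 < 2%:R)) ?ltr0n //.
apply: le_trans (le_trans (_ : _ <= _) le4) _.
  by rewrite le_eqVlt; apply/orP; left; apply/eqP; ring.
by rewrite le_eqVlt; apply/orP; left; apply/eqP; ring.
Qed.

(** At [t = n - 2] the bound [var_param] becomes [V <= (n - 2) (S d - V)]. *)
Lemma var_le : (2 <= n)%N -> d = (n%:R - 1) / n%:R ->
  V <= S * ((n%:R - 2%:R) / n%:R).
Proof.
rewrite leq_eqVlt => /predU1P[n2|n3] dE.
  have := V_ge0; rewrite le0r => /predU1P[->|V0].
    by rewrite -n2 subrr mul0r mulr0.
  (* For n = 2 that parameter is 0 and says nothing; every t > 0 gives
     (2 + t) V <= t S / 2, and t = V / S rules out V > 0. *)
  have := var_param (ltW (divr_gt0 V0 S_gt0)).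
  rewrite dE -n2 subrr mul0r add0r.
  set r := _ ^+ 2 * _; have -> : r = V ^+ 2 / S * (2%:R^-1 - V / S).
    by rewrite /r; field; rewrite gt_eqF.
  rewrite (_ : 2%:R * (V / S) * V = V ^+ 2 / S * 2%:R); last first.
    by field; rewrite gt_eqF.
  rewrite ler_pM2l ?divr_gt0 ?exprn_gt0 // => h.
  have /(le_lt_trans h) : 2%:R^-1 - V / S < 2%:R^-1 :> C.
    by rewrite ltrBlDr ltrDl divr_gt0.
  by rewrite lt_gtF // (lt_trans (_ : _ < 1)) ?invf_lt1 ?ltr0n ?ltr1n.
have k0 : (0 : C) < n%:R - 2%:R by rewrite subr_gt0 ltr_nat.
have n0 : (0 : C) < n%:R by rewrite ltr0n (leq_trans _ n3).
have k1 : (0 : C) < n%:R - 1 by rewrite subr_gt0 ltr1n (leq_trans _ n3).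
have := var_param (ltW k0).
rewrite -subr_ge0 => h.
have : 0 <= (n%:R - 2%:R) * (n%:R - 1) *
   (S * ((n%:R - 2%:R) / n%:R) - V).
  apply: le_trans h _; rewrite dE le_eqVlt; apply/orP; left; apply/eqP.
  by field; rewrite gt_eqF.
by rewrite pmulr_rge0 ?mulr_gt0 // subr_ge0.
Qed.

End Compressed.

(** Subtracting the weighted mean of the diagonal changes nothing, as [z] sums to
    zero, and Cauchy-Schwarz then brings in the variance bounded by [var_le]. *)
Lemma diag_pairing_le n (N : 'M[C]_n) (z : 'I_n -> C) (t : C) :
    (2 <= n)%N ->
    (forall j, \sum_i N i j = 0) -> (forall i, \sum_j N i j = 0) ->
    (forall j, \sum_i `|N i j| ^+ 2 <= (n%:R - 1) / n%:R) ->
    (forall i, \sum_j `|N i j| ^+ 2 <= (n%:R - 1) / n%:R) ->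
    \sum_j z j = 0 -> 0 <= t -> t ^+ 2 = (n%:R - 2%:R) / n%:R ->
  `|\sum_j z j * N j j| <= t * \sum_j `|z j|.
Proof.
move=> n2 c0 r0 c2 r2 z0 t0 tE.
have a_ge0 j : 0 <= `|z j| by [].
have S0 : 0 <= \sum_j `|z j| by exact: sumr_ge0.
have := S0; rewrite le0r => /predU1P[/eqP|Sp].
  rewrite psumr_eq0 // => /allP zz; rewrite big1 ?normr0 ?mulr_ge0 //.
  by move=> j _; have := zz j (mem_index_enum _); rewrite normr_eq0 => /eqP->;
    rewrite mul0r.
have := var_le c0 r0 c2 r2 a_ge0 Sp n2 erefl.
set m := _ / _ => Vle.
have -> : \sum_j z j * N j j = \sum_j z j * (N j j - m).
  by under [RHS]eq_bigr do rewrite mulrBr; rewrite sumrB -mulr_suml z0 mul0r subr0.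
apply: le_trans (ler_norm_sum _ _ _) _.
under eq_bigr do rewrite normrM.
rewrite -ler_sqr ?nnegrE ?mulr_ge0 //; last first.
  by apply: sumr_ge0 => j _; rewrite mulr_ge0.
apply: le_trans (weighted_sqr_sum_le _ _) _ => //.
apply: le_trans (ler_wpM2l S0 Vle) _.
by rewrite exprMn tE mulrA mulrC -expr2.
Qed.

End Pairing.

(** * Phased unitary matrices compressed by the centering projection *)

Lemma mulmx_row_sum0 (R : pzRingType) m n p
    (A : 'M[R]_(m, n)) (B : 'M[R]_(n, p)) i :
  (forall k, \sum_j B k j = 0) -> \sum_j (A *m B) i j = 0.
Proof.
move=> B0; under eq_bigr do rewrite mxE.
by rewrite exchange_big big1 //= => k _; rewrite -mulr_sumr B0 mulr0.
Qed.

Lemma mulmx_col_sum0 (R : pzRingType) m n p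
    (A : 'M[R]_(m, n)) (B : 'M[R]_(n, p)) j :
  (forall k, \sum_i A i k = 0) -> \sum_i (A *m B) i j = 0.
Proof.
move=> A0; under eq_bigr do rewrite mxE.
by rewrite exchange_big big1 //= => k _; rewrite -mulr_suml A0 mul0r.
Qed.

Section Contractions.
Variable C : numClosedFieldType.

Definition sqnorm n (x : 'cV[C]_n) := \sum_i `|x i 0| ^+ 2.

Lemma sqnormE n (x : 'cV[C]_n) : sqnorm x = (x^t* *m x) 0 0.
Proof.
by rewrite mxE; apply: eq_bigr => i _; rewrite !mxE normCKC.
Qed.

Lemma sqnorm_unitary n (U : 'M[C]_n) (x : 'cV[C]_n) :
  U \is unitarymx -> sqnorm (U *m x) = sqnorm x.
Proof.
move=> /unitarymxP/mulmx1C UU.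
by rewrite !sqnormE trmx_mul map_mxM mulmxA -[_ *m _ *m U]mulmxA UU mulmx1.
Qed.

Lemma sqnorm_diag n (th : 'I_n -> C) (x : 'cV[C]_n) :
  (forall i, `|th i| <= 1) -> sqnorm (diag_mx (\row_i th i) *m x) <= sqnorm x.
Proof.
move=> th1; apply: ler_sum => i _; rewrite mul_diag_mx !mxE normrM exprMn.
by rewrite ler_piMl ?exprn_ge0 // exprn_ile1.
Qed.

Lemma centeringC n : (centering C n)^t* = centering C n.
Proof.
rewrite trmx_centering; apply/matrixP => i j; rewrite !mxE rmorphB /=.
by rewrite fmorphV /= !rmorph_nat.
Qed.

(** Pythagoras for the orthogonal projection. *)
Lemma sqnorm_centering n (x : 'cV[C]_n) : (0 < n)%N ->
  sqnorm (centering C n *m x) <= sqnorm x.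
Proof.
move=> n0; have := centering_idem C n0; have := centeringC n.
move: (centering C n) => P PC PP.
suff -> : sqnorm x = sqnorm (P *m x) + sqnorm (x - P *m x).
  by rewrite lerDl; apply: sumr_ge0 => i _; exact: exprn_ge0.
have -> : sqnorm (x - P *m x) = ((x^t* - (P *m x)^t*) *m (x - P *m x)) 0 0.
  by rewrite sqnormE -map_mxB -linearB.
have -> : (P *m x)^t* = x^t* *m P by rewrite trmx_mul map_mxM /= PC.
have -> : sqnorm (P *m x) = (x^t* *m P *m x) 0 0.
  by rewrite sqnormE trmx_mul map_mxM /= PC !mulmxA -[_ *m P *m P]mulmxA PP.
rewrite sqnormE mulmxBl !mulmxBr !mulmxA -[_ *m P *m P]mulmxA PP subrr subr0.
by rewrite [X in _ + X]mxE [X in _ + (_ + X)]mxE addrC subrK.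
Qed.

Lemma sqnorm_col_centering n j : (0 < n)%N ->
  sqnorm (col j (centering C n)) = (n%:R - 1) / n%:R.
Proof.
move=> n0; have nz : n%:R != 0 :> C by rewrite pnatr_eq0 -lt0n.
transitivity ((centering C n *m centering C n) j j).
  rewrite mxE; apply: eq_bigr => i _.
  have -> : centering C n j i = (centering C n i j)^*.
    by rewrite -{1}(centeringC n) 2!mxE.
  by rewrite mxE normCKC.
by rewrite centering_idem // !mxE eqxx mulr1n; field.
Qed.

(** A matrix [U^* Theta U] with entries of [Theta] in the unit disc is a
    contraction, so column [j] is at most as long as [P e_j]. *)
Lemma compression_col n (U : 'M[C]_n) (th : 'I_n -> C) j :
    (0 < n)%N -> U \is unitarymx -> (forall i, `|th i| <= 1) ->
  \sum_i `|(centering C n *m (U^t* *m diag_mx (\row_i th i) *m U)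
            *m centering C n) i j| ^+ 2 <= (n%:R - 1) / n%:R.
Proof.
move=> n0 uU th1; rewrite -(sqnorm_col_centering j n0).
set P := centering C n; set M := _ *m P.
have -> : \sum_i `|M i j| ^+ 2 = sqnorm (col j M).
  by apply: eq_bigr => i _; rewrite !mxE.
rewrite colE /M -!mulmxA -colE.
apply: le_trans (sqnorm_centering _ n0) _.
rewrite sqnorm_unitary ?trmxC_unitary //.
apply: le_trans (sqnorm_diag _ th1) _.
by rewrite sqnorm_unitary.
Qed.

(** Transposition turns the matrix into the one built from the conjugate of [U]. *)
Lemma compression_row n (U : 'M[C]_n) (th : 'I_n -> C) i :
    (0 < n)%N -> U \is unitarymx -> (forall i, `|th i| <= 1) ->
  \sum_j `|(centering C n *m (U^t* *m diag_mx (\row_i th i) *m U)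
            *m centering C n) i j| ^+ 2 <= (n%:R - 1) / n%:R.
Proof.
move=> n0 uU th1.
have uV : map_mx Num.conj U \is unitarymx by rewrite conjC_unitary.
have := compression_col i n0 uV th1.
set M' := _ *m _ *m _; set M := _ *m _ *m _; have -> : M' = M^T.
  rewrite /M !trmx_mul trmx_centering tr_diag_mx !mulmxA /M' !mulmxA.
  congr (_ *m _ *m _ *m _ *m _).
    by apply/matrixP => k l; rewrite !mxE conjCK.
  by apply/matrixP => k l; rewrite !mxE.
by under eq_bigr do rewrite mxE.
Qed.

End Contractions.

(** * The inequality for critical points *)

Section CriticalPoints.
Variable C : numClosedFieldType.

(** The zeros of [X q] are those of [q] and [0], which adds nothing to the sum of
    moduli; the constant [c] is [1] since both products are monic. *)
Lemma sum_norm_roots_mulX n m (x : 'I_n -> C) (y : 'I_m -> C) (c : C) :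
  \prod_i ('X - (x i)%:P) = c *: ('X * \prod_k ('X - (y k)%:P)) ->
  \sum_i `|x i| = \sum_k `|y k|.
Proof.
move=> e; have c1 : c = 1.
  have := congr1 lead_coef e; rewrite lead_coefZ.
  rewrite (monicP (monic_prod_XsubC _ _ _)) (monicP _) ?mulr1 //.
  by rewrite monicMl ?monicX // monic_prod_XsubC.
rewrite c1 scale1r in e.
have : perm_eq [seq x i | i <- index_enum 'I_n]
               (0 :: [seq y k | k <- index_enum 'I_m]).
  by apply: prod_XsubC_eq; rewrite big_cons !big_map subr0.
move=> /(perm_big _) E; rewrite -(big_map x xpredT Num.norm) (E _ _ _ xpredT).
by rewrite /= big_cons normr0 add0r big_map.
Qed.

Lemma sum_norm_critical_le n (z : 'I_n -> C) (w : 'I_n.-1 -> C) (c t : C) :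
    (2 <= n)%N -> \sum_j z j = 0 ->
    (\prod_j ('X - (z j)%:P))^`() = c *: \prod_k ('X - (w k)%:P) ->
    0 <= t -> t ^+ 2 = (n%:R - 2%:R) / n%:R ->
  \sum_k `|w k| <= t * \sum_j `|z j|.
Proof.
move=> n2 z0 hw t0 tE; have n0 : (0 < n)%N by exact: ltnW.
set P := centering C n; pose A := P *m diag_mx (\row_j z j) *m P.
have [U uU] := Schur A n0; rewrite /similar_to conjymx //.
set T := U *m A *m _ => trigT.
have AT : char_poly T = char_poly A.
  by rewrite /T char_poly_mulmxC mulmxA (mulmx1C (unitarymxP uU)) mul1mx.
(* The phase of the conjugate eigenvalue; it is 0 at a zero eigenvalue, since
   division by 0 yields 0. *)
pose th k := (T k k)^* / `|T k k|.
have th1 k : `|th k| <= 1.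
  rewrite /th normrM norm_conjC normfV normr_id.
  by have [->|?] := eqVneq `|T k k| 0; rewrite ?mul0r ?divff.
have thT k : th k * T k k = `|T k k|.
  rewrite /th mulrAC -normCKC.
  by have [->|?] := eqVneq `|T k k| 0; rewrite ?invr0 ?mulr0 // expr2 mulfK.
have <- : \sum_k `|T k k| = \sum_k `|w k|.
  apply: (@sum_norm_roots_mulX _ _ _ _ (n%:R^-1 * c)).
  by rewrite -(char_poly_trig trigT) AT char_poly_centering // hw scalerA
     scalerAr.
pose N := P *m (U^t* *m diag_mx (\row_i th i) *m U) *m P.
rewrite -[leLHS]ger0_norm ?sumr_ge0 //.
have -> : \sum_k `|T k k| = \sum_j z j * N j j.
  have -> : \sum_k `|T k k| = \tr (diag_mx (\row_i th i) *m T).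
    by apply: eq_bigr => k _; rewrite mul_diag_mx [RHS]mxE [X in _ = X * _]mxE thT.
  have -> : \sum_j z j * N j j = \tr (diag_mx (\row_j z j) *m N).
    by apply: eq_bigr => k _; rewrite mul_diag_mx [RHS]mxE [X in _ = X * _]mxE.
  have -> : diag_mx (\row_j z j) *m N = (diag_mx (\row_j z j) *m P *m U^t* ) *m
      (diag_mx (\row_i th i) *m U *m P) by rewrite /N !mulmxA.
  by rewrite [RHS]mxtrace_mulC /T /A !mulmxA.
have NT0 i : \sum_j N i j = 0.
  by apply: mulmx_row_sum0 => k; exact: centering_row_sum0.
have N0 j : \sum_i N i j = 0.
  rewrite /N -mulmxA; apply: mulmx_col_sum0 => k.
  rewrite -[RHS](centering_row_sum0 C n0 k); apply: eq_bigr => i _.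
  by rewrite -[in RHS]trmx_centering [RHS]mxE.
by apply: diag_pairing_le => // i; [exact: compression_col|exact: compression_row].
Qed.

End CriticalPoints.

Local Open Scope complex_scope.
Theorem theorem3p4 (R : realType) (n : nat) (hn : (2 <= n)%N) (p : {poly R[i]})
    (z : 'I_n -> R[i]) (w : 'I_n.-1 -> R[i])
    (hp : p = \prod_(j < n) ('X - (z j)%:P))
    (hw : critical_points p w)
    (hz : \sum_(j < n) z j = 0) :
  \sum_(k < n.-1) `|w k|
    <= (Num.sqrt ((n%:R - 2%:R) / n%:R))%:C * \sum_(j < n) `|z j|.
Proof.
case: hw => _; rewrite hp => hw.
apply: (sum_norm_critical_le hn hz hw); first by rewrite lecR sqrtr_ge0.
rewrite -rmorphXn /= sqr_sqrtr; last by rewrite divr_ge0 // subr_ge0 ler_nat.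
by rewrite rmorphM fmorphV rmorphB /= !rmorph_nat.
Qed.
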